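(* Let $f:\mathbb{R}^n\to\mathbb{R}$ and $c:\mathbb{R}^n\to\mathbb{R}^m$ be continuously differentiable with locally Lipschitz continuous derivatives, let $g:\mathbb{R}^n\to\mathbb{R}\cup\{\infty\}$ be proper, lower semicontinuous and prox-bounded, let $D\subset\mathbb{R}^m$ be nonempty and closed, and put $q:=f+g$. Consider a sequence $\{(x^k,s^k)\}_{k\in\mathbb{N}}$ of iterates generated by the augmented Lagrangian method (described in the context) with $\{\varepsilon_k\}$ bounded. Let $(x^*,s^* )$ be an accumulation point of $\{(x^k,s^k)\}$ and let $\{(x^k,s^k)\}_{k\in K}$ be a subsequence such that, as $k\to\infty$ in $K$, $x^k\to x^*\in\operatorname{dom}q$ with $q(x^k)\to q(x^* )$, and $s^k\to s^*$. Then $(x^*,q(x^* ),s^* )$ is an M-stationary point of the feasibility problem $$\min_{(x,\alpha,s)\in\operatorname{epi}q\times D}\ \tfrac12\|c(x)-s\|^2 .$$ If, moreover, $q$ is locally Lipschitz continuous at $x^*$, then $(x^*,s^* )$ is an M-stationary point of the constraint violation problem $$\min_{(x,s)\in\mathbb{R}^n\times D}\ \tfrac12\|c(x)-s\|^2 .$$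
   Context: **Basic notions.** For $h:\mathbb{R}^N\to\mathbb{R}\cup\{\infty\}$, $\operatorname{dom}h=\{x: h(x)<\infty\}$ and $\operatorname{epi}h=\{(x,\alpha)\in\mathbb{R}^N\times\mathbb{R}: h(x)\le\alpha\}$; $h$ is proper if $\operatorname{dom}h\neq\emptyset$, and prox-bounded if it is proper and $h+\|\cdot\|^2/(2\gamma)$ is bounded below for some $\gamma>0$. For $h$ proper and lower semicontinuous and $\bar x\in\operatorname{dom}h$, the regular subdifferential is $\hat\partial h(\bar x)=\{v:\liminf_{x\to\bar x,\,x\ne\bar x}\frac{h(x)-h(\bar x)-\langle v,x-\bar x\rangle}{\|x-\bar x\|}\ge 0\}$, and the (limiting) subdifferential $\partial h(\bar x)$ is the set of $v$ for which there are $x^j\to\bar x$ with $h(x^j)\to h(\bar x)$ and $v^j\in\hat\partial h(x^j)$ with $v^j\to v$; both are empty if $\bar x\notin\operatorname{dom}h$. For a closed nonempty set $C$ with projection $\Pi_C(v)=\operatorname{argmin}_{z\in C}\|z-v\|$, the limiting normal cone at $z\in C$ is $\mathcal N_C^{\lim}(z)=\limsup_{v\to z}\operatorname{cone}(v-\Pi_C(v))$ (outer limit: all limits of $w^j\in\operatorname{cone}(v^j-\Pi_C(v^j))$ with $v^j\to z$), and $\mathcal N_C^{\lim}(z)=\emptyset$ for $z\notin C$. **M-stationarity.** For a continuously differentiable function $F$ and a closed set $C$, a point $z^*$ is M-stationary for $\min_{z\in C}F(z)$ if $z^*\in C$ and $-\nabla F(z^* )\in\mathcal N_C^{\lim}(z^*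 )$. **Augmented Lagrangian.** For $\mu>0$, with $\delta_D$ the indicator function of $D$ ($0$ on $D$, $\infty$ elsewhere), $\mathcal L^S_\mu(x,s,y)=q(x)+\delta_D(s)+\langle y,c(x)-s\rangle+\frac1{2\mu}\|c(x)-s\|^2$. For $\varepsilon\ge0$, $(x,s)$ is an $\varepsilon$-stationary point of $\mathcal L^S_\mu(\cdot,\cdot,y)$ if there is $\eta$ in the limiting subdifferential of the function $\mathcal L^S_\mu(\cdot,\cdot,y)$ at $(x,s)$ with $\|\eta\|\le\varepsilon$. **Augmented Lagrangian method.** Fix $\mu_0>0$, $\theta,\kappa\in(0,1)$ and a nonempty bounded set $Y\subset\mathbb{R}^m$. For $k=0,1,2,\dots$: (1) select $\hat y^k\in Y$ and $\varepsilon_k\ge0$; (2) compute an $\varepsilon_k$-stationary point $(x^k,s^k)\in\mathbb{R}^n\times D$ of $\mathcal L^S_{\mu_k}(\cdot,\cdot,\hat y^k)$; (3) set $y^k=\hat y^k+[c(x^k)-s^k]/\mu_k$; (4) if $k=0$ or $\|c(x^k)-s^k\|\le\theta\|c(x^{k-1})-s^{k-1}\|$, set $\mu_{k+1}=\mu_k$; otherwise select $\mu_{k+1}\in(0,\kappa\mu_k]$. It is assumed that the method is well defined, i.e. each step (2) can be carried out, so that an infinite sequence is generated. *)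

(* Defs.v *)
From HB Require Import structures.
From mathcomp Require Import all_boot all_order all_algebra.
From mathcomp Require Import all_classical all_reals all_analysis.

Set Implicit Arguments.
Unset Strict Implicit.
Unset Printing Implicit Defensive.
Import Order.TTheory GRing.Theory Num.Theory.
Import numFieldNormedType.Exports.

Local Open Scope classical_set_scope.
Local Open Scope ring_scope.

(* R^N is 'rV[R]_N, and R^n x R^m is 'rV[R]_(n + m) through row_mx, lsubmx and
   rsubmx.  The norm `|_| that the library puts on 'rV[R]_N is the sup norm.
   It is used only where nothing depends on the choice of a norm (topology,
   differentiability, boundedness, local Lipschitz continuity); everywhere else
   the Euclidean norm enorm is used. *)

Section Euclidean.
Context {R : realType} {N : nat}.
Implicit Types u v : 'rV[R]_N.

Definition dotp u v : R := \sum_i u 0 i * v 0 i.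

Definition enorm u : R := Num.sqrt (dotp u u).

Definition gradient (F : 'rV[R]_N -> R) (z : 'rV[R]_N) : 'rV[R]_N :=
  \row_i ('D_(delta_mx 0 i) F z : R).

End Euclidean.

Definition setprod_rv {R : realType} {n m : nat}
    (A : set 'rV[R]_n) (B : set 'rV[R]_m) : set 'rV[R]_(n + m) :=
  [set z | A (lsubmx z) /\ B (rsubmx z)].

Definition locally_lipschitz {R : realType} {V W : normedModType R}
    (f : V -> W) : Prop :=
  forall x : V, lipschitz_on f (nbhs (x, x)).

(* Functions R^N -> R u {oo} are functions into \bar R that avoid -oo; this is
   part of [proper_ext]. *)
Section ExtendedValued.
Context {R : realType} {N : nat}.
Implicit Types (h : 'rV[R]_N -> \bar R) (C : set 'rV[R]_N).
Local Open Scope ereal_scope.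

Definition edom h : set 'rV[R]_N := [set x | h x < +oo].

Definition epi h : set 'rV[R]_(N + 1) :=
  [set z | h (lsubmx z) <= (rsubmx z 0%R 0%R)%:E].

Definition proper_ext h : Prop := (forall x, h x != -oo) /\ edom h !=set0.

Definition prox_bounded h : Prop :=
  proper_ext h /\
  exists gamma : R, (0 < gamma)%R /\
  exists B : R, forall x, B%:E <= h x + (enorm x ^+ 2 / (2 * gamma))%:E.

Definition indicator C (x : 'rV[R]_N) : \bar R := if x \in C then 0 else +oo.

Definition locally_lipschitz_ext_at h (x : 'rV[R]_N) : Prop :=
  (\forall u \near x, h u \is a fin_num) /\
  lipschitz_on (fine \o h) (nbhs (x, x)).

Definition regular_subdiff h (xb : 'rV[R]_N) : set 'rV[R]_N :=
  [set v | edom h xb /\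
    0 <= limf_einf (fun x => (h x - h xb - (dotp v (x - xb))%:E)
                             * (enorm (x - xb))^-1%:E) xb^'].

Definition limiting_subdiff h (xb : 'rV[R]_N) : set 'rV[R]_N :=
  [set v | edom h xb /\
    exists xs vs : nat -> 'rV[R]_N,
      [/\ xs j @[j --> \oo] --> xb,
          h (xs j) @[j --> \oo] --> h xb,
          forall j, regular_subdiff h (xs j) (vs j) &
          vs j @[j --> \oo] --> v]].

End ExtendedValued.

Section NormalCone.
Context {R : realType} {N : nat}.
Implicit Types C A : set 'rV[R]_N.

Definition metric_proj C (v : 'rV[R]_N) : set 'rV[R]_N :=
  [set z | C z /\ forall w, C w -> enorm (z - v) <= enorm (w - v)].

(* Not the convex hull: the set of nonnegative multiples. *)
Definition cone A : set 'rV[R]_N :=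
  [set w | exists2 t : R, 0 <= t & exists2 a, A a & w = t *: a].

Definition limiting_normal C (z : 'rV[R]_N) : set 'rV[R]_N :=
  [set w | C z /\
    exists vs ws : nat -> 'rV[R]_N,
      [/\ vs j @[j --> \oo] --> z,
          forall j, cone [set vs j - p | p in metric_proj C (vs j)] (ws j) &
          ws j @[j --> \oo] --> w]].

(* Meant for continuously differentiable F. *)
Definition M_stationary (F : 'rV[R]_N -> R) C (z : 'rV[R]_N) : Prop :=
  C z /\ limiting_normal C z (- gradient F z).

End NormalCone.

Section AugmentedLagrangian.
Context {R : realType} {n m : nat}.
Variables (q : 'rV[R]_n -> \bar R) (c : 'rV[R]_n -> 'rV[R]_m).
Variable D : set 'rV[R]_m.

Definition aug_lagrangian (mu : R) (y : 'rV[R]_m) (z : 'rV[R]_(n + m)) : \bar R :=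
  let x := lsubmx z in let s := rsubmx z in
  (q x + indicator D s
   + (dotp y (c x - s) + (2 * mu)^-1 * enorm (c x - s) ^+ 2)%:E)%E.

Definition eps_stationary (mu : R) (y : 'rV[R]_m) (eps : R)
    (x : 'rV[R]_n) (s : 'rV[R]_m) : Prop :=
  exists2 eta, limiting_subdiff (aug_lagrangian mu y) (row_mx x s) eta &
    enorm eta <= eps.

Record alm_run (mu0 theta kappa : R) (Y : set 'rV[R]_m)
    (mu eps : nat -> R) (yhat y : nat -> 'rV[R]_m)
    (x : nat -> 'rV[R]_n) (s : nat -> 'rV[R]_m) : Prop := AlmRun {
  alm_mu0 : mu 0%N = mu0;
  alm_yhat : forall k, Y (yhat k);
  alm_eps : forall k, 0 <= eps k;
  alm_feasible : forall k, D (s k);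
  alm_stationary : forall k, eps_stationary (mu k) (yhat k) (eps k) (x k) (s k);
  alm_y : forall k, y k = yhat k + (mu k)^-1 *: (c (x k) - s k);
  alm_mu : forall k,
    if (k == 0%N) ||
       (enorm (c (x k) - s k) <= theta * enorm (c (x k.-1) - s k.-1))
    then mu k.+1 = mu k
    else 0 < mu k.+1 <= kappa * mu k }.

End AugmentedLagrangian.

Section Violation.
Context {R : realType} {n m : nat}.
Variable c : 'rV[R]_n -> 'rV[R]_m.

Definition violation (z : 'rV[R]_(n + m)) : R :=
  2^-1 * enorm (c (lsubmx z) - rsubmx z) ^+ 2.

(* The variable is ((x, alpha), s), with alpha in the middle block. *)
Definition epi_violation (z : 'rV[R]_(n + 1 + m)) : R :=
  2^-1 * enorm (c (lsubmx (lsubmx z)) - rsubmx z) ^+ 2.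

End Violation.

(* Main.v *)
Require Import Defs.
From HB Require Import structures.
From mathcomp Require Import all_boot all_order all_algebra.
From mathcomp Require Import all_classical all_reals all_analysis.
From mathcomp Require Import ring lra.

Set Implicit Arguments.
Unset Strict Implicit.
Unset Printing Implicit Defensive.
Import Order.TTheory GRing.Theory Num.Theory.
Import numFieldNormedType.Exports.

Local Open Scope classical_set_scope.
Local Open Scope ring_scope.

(** Let L_k be the augmented Lagrangian of step k, and r = c xs - ss the residual
    at the accumulation point.  The negative gradients of the two violation
    functions are (- J^T r, 0, r) on the epigraphical space and (- J^T r, r) on
    the original one, with J the m x n Jacobian matrix of c at xs (so that J^T r
    is r *m (jacobian c xs)^T on row vectors); they have to be limiting normals.

    If the penalty parameters stop decreasing, the test of the method contracts
    the residuals geometrically, so r = 0, both gradients vanish, and 0 is always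
    a limiting normal.
    Otherwise mu_k tends to 0 ([alm_dichotomy]).  An approximate stationary point
    of L_k has nearby points (u, t), with q-values near those of the iterates,
    at which L_k has a regular subgradient v that is bounded independently of k
    ([limiting_subdiff_aug_lagrangian]).
    Removing the smooth part of L_k leaves a regular subgradient
      w = v - (J_u^T p, - p),   p = yhat_k + (c u - t) / mu_k,
    of q x + delta_D s ([regular_subdiff_aug_lagrangian]), and
    (w_x, -1, w_s) is a regular normal to epi q x D
    ([frechet_subgradient_epi]).  Normals may be rescaled: multiplied by mu_k,
    they become (mu_k w_x, - mu_k, mu_k w_s), and since v and yhat_k are bounded
    this converges to (- J^T r, 0, r) ([cvg_penalized_subgradient]).

    The limiting normal cone is defined through projections rather than through
    regular normals, so it remains to see that limits of regular normals are
    limits of proximal ones: [frechet_normal_proximal] and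
    [limiting_normal_lim].

    When q is Lipschitz around xs, the w_x are bounded
    ([frechet_subgradient_lipschitz]), hence mu_k w_x tends to 0 and J^T r = 0;
    the vectors (0, mu_k w_s) are regular normals to R^n x D
    ([frechet_subgradient_prodT]) and converge to (0, r). *)

(** * Euclidean inner product and norm *)

Lemma le_of_sqr_le {R : realDomainType} (x a : R) :
  0 <= a -> x ^+ 2 <= a * x -> x <= a.
Proof.
by move=> a0 xa; case: (lerP x 0) => x0; [exact: le_trans a0 | rewrite -(ler_pM2r x0)].
Qed.

Section Dotp.
Context {R : realType} {N : nat}.
Implicit Types (u v w : 'rV[R]_N) (a : R).

Lemma dotpC u v : dotp u v = dotp v u.
Proof. by apply: eq_bigr => i _; rewrite mulrC. Qed.

Lemma dotpDl u v w : dotp (u + v) w = dotp u w + dotp v w.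
Proof. by rewrite -big_split; apply: eq_bigr => i _; rewrite mxE mulrDl. Qed.

Lemma dotpZl a u v : dotp (a *: u) v = a * dotp u v.
Proof. by rewrite mulr_sumr; apply: eq_bigr => i _; rewrite mxE mulrA. Qed.

Lemma dotpNl u v : dotp (- u) v = - dotp u v.
Proof. by rewrite -scaleN1r dotpZl mulN1r. Qed.

Lemma dotp0l u : dotp 0 u = 0.
Proof. by rewrite -(scale0r u) dotpZl mul0r. Qed.

Lemma dotpDr u v w : dotp u (v + w) = dotp u v + dotp u w.
Proof. by rewrite !(dotpC u) dotpDl. Qed.

Lemma dotpZr a u v : dotp u (a *: v) = a * dotp u v.
Proof. by rewrite !(dotpC u) dotpZl. Qed.

Lemma dotpNr u v : dotp u (- v) = - dotp u v.
Proof. by rewrite !(dotpC u) dotpNl. Qed.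

Lemma dotp_ge0 u : 0 <= dotp u u.
Proof. by apply: sumr_ge0 => i _; rewrite -expr2 sqr_ge0. Qed.

Lemma dotp_delta u i : dotp u (delta_mx 0 i) = u 0 i.
Proof.
rewrite /dotp (bigD1 i)//= big1 ?addr0 => [|j jneqi].
  by rewrite mxE !eqxx mulr1.
by rewrite mxE (negbTE jneqi) mulr0.
Qed.

Lemma enorm_ge0 u : 0 <= enorm u.
Proof. exact: sqrtr_ge0. Qed.

Lemma sqr_enorm u : enorm u ^+ 2 = dotp u u.
Proof. by rewrite sqr_sqrtr ?dotp_ge0. Qed.

Lemma enorm0 : enorm (0 : 'rV[R]_N) = 0.
Proof. by rewrite /enorm dotp0l sqrtr0. Qed.

Lemma enormZ a u : enorm (a *: u) = `|a| * enorm u.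
Proof.
by rewrite /enorm dotpZl dotpZr mulrA -expr2 sqrtrM ?sqr_ge0// sqrtr_sqr.
Qed.

Lemma ler_coord u i : `|u 0 i| <= `|u|.
Proof.
rewrite [leRHS]/Num.norm/= mx_normrE; apply/bigmax_geP; right.
by exists (0, i).
Qed.

Lemma norm_le_enorm u : `|u| <= enorm u.
Proof.
rewrite [leLHS]/Num.norm/= mx_normrE; apply/bigmax_leP; split.
  exact: enorm_ge0.
move=> [i j] _ /=; rewrite (ord1 i) -sqrtr_sqr ler_wsqrtr//.
rewrite /dotp (bigD1 j)//= -expr2 lerDl; apply: sumr_ge0 => k _.
by rewrite -expr2 sqr_ge0.
Qed.

(** A dimension-dependent constant in place of the sharp Cauchy-Schwarz bound:
    only first-order estimates up to a constant factor are needed below. *)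
Lemma normr_dotp_le u v : `|dotp u v| <= N%:R * (`|u| * `|v|).
Proof.
apply: le_trans (ler_norm_sum _ _ _) _.
apply: (@le_trans _ _ (\sum_(i < N) `|u| * `|v|)).
  by apply: ler_sum => i _; rewrite normrM ler_pM ?ler_coord.
by rewrite sumr_const card_ord mulr_natl.
Qed.

End Dotp.

Lemma le_enorm {R : realType} {n m : nat} (u : 'rV[R]_n) (v : 'rV[R]_m) :
  (enorm u <= enorm v) = (dotp u u <= dotp v v).
Proof. by rewrite ler_psqrt// nnegrE dotp_ge0. Qed.

Section DotpBlocks.
Context {R : realType} {n m : nat}.

Lemma dotp_row_mx (a c : 'rV[R]_n) (b d : 'rV[R]_m) :
  dotp (row_mx a b) (row_mx c d) = dotp a c + dotp b d.
Proof.
rewrite /dotp big_split_ord/=; congr (_ + _); apply: eq_bigr => i _.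
  by rewrite !row_mxEl.
by rewrite !row_mxEr.
Qed.

Lemma dotp_hsub (a : 'rV[R]_n) (b : 'rV[R]_m) z :
  dotp (row_mx a b) z = dotp a (lsubmx z) + dotp b (rsubmx z).
Proof. by rewrite -[in LHS](hsubmxK z) dotp_row_mx. Qed.

Lemma dotp_mulmx (u : 'rV[R]_m) (v : 'rV[R]_n) (A : 'M[R]_(n, m)) :
  dotp u (v *m A) = dotp (u *m A^T) v.
Proof.
have E k (a b : 'rV[R]_k) : dotp a b = (a *m b^T) 0 0.
  by rewrite mxE; apply: eq_bigr => i _; rewrite mxE.
by rewrite !E trmx_mul mulmxA.
Qed.

Lemma enorm_row_mx0 (a : 'rV[R]_n) : enorm (row_mx a (0 : 'rV[R]_m)) = enorm a.
Proof. by rewrite /enorm dotp_row_mx dotp0l addr0. Qed.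

Lemma enorm_row_0mx (b : 'rV[R]_m) : enorm (row_mx (0 : 'rV[R]_n) b) = enorm b.
Proof. by rewrite /enorm dotp_row_mx dotp0l add0r. Qed.

End DotpBlocks.

(** * Convergence of vectors and matrices by coordinates *)

Lemma cvg_mx {R : realType} {T : Type} {F : set_system T} {FF : Filter F} n m
    (u : T -> 'M[R]_(n, m)) (l : 'M[R]_(n, m)) :
  (forall i j, u t i j @[t --> F] --> l i j) -> u t @[t --> F] --> l.
Proof.
move=> ul; apply/cvg_mx_entourageP => A entA.
have H i j : \forall t \near F, (l i j, u t i j) \in A.
  have /cvg_entourageP/(_ A entA) /= ulA := ul i j.
  by move: ulA; apply: (@filterS _ F) => t /=; rewrite inE.
by apply: filter_forall => i; apply: filter_forall => j; exact: H.
Qed.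

Lemma cvg_coord {R : realType} {T : Type} {F : set_system T} {FF : Filter F} n m
    (u : T -> 'M[R]_(n, m)) (l : 'M[R]_(n, m)) i j :
  u t @[t --> F] --> l -> u t i j @[t --> F] --> l i j.
Proof.
move=> ul; apply: (cvg_comp _ (fun M : 'M[R]_(n, m) => M i j) ul).
exact: coord_continuous.
Qed.

Lemma cvg_row_mx {R : realType} {T : Type} {F : set_system T} {FF : Filter F}
    n m (u : T -> 'rV[R]_n) (v : T -> 'rV[R]_m)
    (a : 'rV[R]_n) (b : 'rV[R]_m) :
  u t @[t --> F] --> a -> v t @[t --> F] --> b ->
  row_mx (u t) (v t) @[t --> F] --> row_mx a b.
Proof.
move=> ua vb; apply: cvg_mx => i j; rewrite [row_mx a b _ _]mxE.
under eq_fun do rewrite mxE.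
by case: splitP => k _; exact: cvg_coord.
Qed.

Lemma cvg_lsubmx {R : realType} {T : Type} {F : set_system T} {FF : Filter F}
    n m (u : T -> 'rV[R]_(n + m)) (a : 'rV[R]_n) (b : 'rV[R]_m) :
  u t @[t --> F] --> row_mx a b -> lsubmx (u t) @[t --> F] --> a.
Proof.
move=> uab; have := cvg_comp _ lsubmx uab (@continuous_lsubmx _ _ _ _ _).
by rewrite row_mxKl.
Qed.

Lemma cvg_rsubmx {R : realType} {T : Type} {F : set_system T} {FF : Filter F}
    n m (u : T -> 'rV[R]_(n + m)) (a : 'rV[R]_n) (b : 'rV[R]_m) :
  u t @[t --> F] --> row_mx a b -> rsubmx (u t) @[t --> F] --> b.
Proof.
move=> uab; have := cvg_comp _ rsubmx uab (@continuous_rsubmx _ _ _ _ _).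
by rewrite row_mxKr.
Qed.

Lemma cvg_scalar_mx11 {R : realType} {T : Type} {F : set_system T}
    {FF : Filter F} (a : T -> R) (l : R) :
  a t @[t --> F] --> l -> (a t)%:M @[t --> F] --> (l%:M : 'M[R]_1).
Proof.
move=> al; apply: cvg_mx => i j; rewrite [l%:M _ _]mxE !ord1 mulr1n.
by under eq_fun do rewrite mxE mulr1n.
Qed.

Lemma cvg_sum_fun {R : realType} {T : Type} {F : set_system T} {FF : Filter F}
    k (h : 'I_k -> T -> R) (l : 'I_k -> R) :
  (forall i, h i t @[t --> F] --> l i) ->
  \sum_i h i t @[t --> F] --> \sum_i l i.
Proof.
move=> hl; rewrite -fct_sumE.
by elim/big_ind2 : _ => // [|u x v y ux vy]; [exact: cvg_cst | exact: cvgD].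
Qed.

Lemma cvg_mulmx_tr {R : realType} {T : Type} {F : set_system T} {FF : Filter F}
    n m (u : T -> 'rV[R]_m) (A : T -> 'M[R]_(n, m))
    (a : 'rV[R]_m) (B : 'M[R]_(n, m)) :
  u t @[t --> F] --> a -> A t @[t --> F] --> B ->
  u t *m (A t)^T @[t --> F] --> a *m B^T.
Proof.
move=> ua AB; apply: cvg_mx => i j; rewrite [(a *m _) _ _]mxE.
under eq_fun do rewrite mxE.
apply: cvg_sum_fun => k; rewrite [B^T _ _]mxE.
under eq_fun do rewrite [(A _)^T _ _]mxE.
by apply: cvgM; exact: cvg_coord.
Qed.

Lemma cvg_dotp {R : realType} {T : Type} {F : set_system T} {FF : Filter F}
    m (u v : T -> 'rV[R]_m) (a b : 'rV[R]_m) :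
  u t @[t --> F] --> a -> v t @[t --> F] --> b ->
  dotp (u t) (v t) @[t --> F] --> dotp a b.
Proof.
by move=> ua vb; apply: cvg_sum_fun => k; apply: cvgM; exact: cvg_coord.
Qed.

(** * Projections onto closed sets *)

Section Projection.
Context {R : realType} {N : nat}.
Implicit Types (C : set 'rV[R]_N) (v : 'rV[R]_N).

Lemma enorm_continuous : continuous (@enorm R N).
Proof.
move=> z; apply: (cvg_comp (fun u => dotp u u) Num.sqrt).
  by apply: (@cvg_dotp _ _ (nbhs z)); exact: cvg_id.
exact: sqrt_continuous.
Qed.

(** Only the points of C at least as close to v as a fixed one matter, and they
    form a compact set. *)
Lemma metric_proj_neq0 C v : closed C -> C !=set0 -> metric_proj C v !=set0.
Proof.
move=> cC [z0 Cz0]; pose r := enorm (z0 - v).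
pose d := fun w => enorm (w - v).
have dcont : continuous d.
  move=> w; apply: (cvg_comp (fun u => u - v) (@enorm R N)).
    by apply: (@cvgB _ _ _ (nbhs w)); [exact: cvg_id | exact: cvg_cst].
  exact: enorm_continuous.
pose A := C `&` [set w | d w <= r].
have cA : closed A.
  apply: closedI => //; have := closed_comp (f := d) (D := [set x | x <= r]).
  by apply=> [w _|]; [exact: dcont | exact: closed_le].
have bA : bounded_set A.
  exists (r + `|v|); split; first exact: num_real.
  move=> x rx w [_ dw] /=; apply: le_trans (ltW rx).
  rewrite -[w](subrK v); apply: le_trans (ler_normD _ _) _.
  by rewrite lerD2r; apply: le_trans (norm_le_enorm _) dw.
have kA : compact A by exact: bounded_closed_compact.
have A0 : A !=set0 by exists z0; split => //=.
have [|p /set_mem[Cp _] pmin] := EVT_min_rV (f := d) A0 kA.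
  exact: continuous_subspaceT.
exists p; split=> // w Cw; have [dw|dw] := leP (d w) r.
  by apply: pmin; rewrite inE.
apply: le_trans (ltW dw); apply: pmin; rewrite inE; split => //=.
Qed.

End Projection.

(** * Regular normals are limits of proximal normals *)

Lemma cvg_of_close {R : realType} {V : normedModType R} (a b : nat -> V)
    (l : V) :
  b j @[j --> \oo] --> l -> (forall j, `|a j - b j| < j.+1%:R^-1) ->
  a j @[j --> \oo] --> l.
Proof.
move=> bl ab; rewrite -(add0r l).
have -> : a = (fun j => (a j - b j) + b j) by apply/funext => j; rewrite subrK.
apply: cvgD => //; apply/norm_cvg0P.
apply: (@squeeze_cvgr _ _ _ _ (fun=> 0) (@harmonic R)).
- by apply: nearW => j /=; rewrite normr_ge0 ltW.
- exact: cvg_cst.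
- exact: cvg_harmonic.
Qed.

Section FrechetNormal.
Context {R : realType} {N : nat}.
Implicit Types (C : set 'rV[R]_N) (z w v : 'rV[R]_N).

(** Regular (Fréchet) normals: the inner product with u - z is bounded by
    o(|u - z|) along C. *)
Definition frechet_normal C z w : Prop :=
  C z /\ forall e : R, 0 < e ->
    \forall u \near z, C u -> dotp w (u - z) <= e * enorm (u - z).

Lemma frechet_normalZ C z w (a : R) :
  0 <= a -> frechet_normal C z w -> frechet_normal C z (a *: w).
Proof.
move=> a0 [Cz wN]; split=> // e e0.
have a1 : 0 < a + 1 by rewrite ltr_wpDl.
have ea : 0 < e / (a + 1) by rewrite divr_gt0.
apply: filterS (wN _ ea) => u Cu /Cu; rewrite dotpZl => wu.
apply: (le_trans (ler_wpM2l a0 wu)).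
rewrite mulrA ler_wpM2r ?enorm_ge0// mulrCA ler_piMr ?(ltW e0)//.
by rewrite ler_pdivrMr// mul1r lerDl.
Qed.

(** Expand the square in |p - (z + t w)| <= |z - (z + t w)|, which holds because
    z competes with p in the projection problem. *)
Lemma metric_proj_shift C z w p (t : R) : 0 <= t -> C z ->
  metric_proj C (z + t *: w) p ->
  dotp (p - z) (p - z) <= 2 * t * dotp w (p - z).
Proof.
move=> t0 Cz [_ /(_ z Cz)]; rewrite le_enorm.
have -> : p - (z + t *: w) = (p - z) - t *: w by rewrite opprD addrA.
have -> : z - (z + t *: w) = - (t *: w) by rewrite opprD addrA subrr add0r.
rewrite !(dotpDl, dotpDr, dotpNl, dotpNr, dotpZl, dotpZr) !(dotpC p w, dotpC z w).
by nra.
Qed.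

(** Push z to z + t w for a small t > 0 and project back to p.  By
    [metric_proj_shift], |p - z|^2 <= 2 t <w, p - z>, so first |p - z| = O(t);
    then p is close to z, regularity of w makes <w, p - z> = o(|p - z|), and the
    same inequality improves to |p - z| = o(t).  Hence the proximal normal
    (z + t w - p) / t = w - (p - z) / t is close to w. *)
Lemma frechet_normal_proximal C z w (e : R) :
  closed C -> frechet_normal C z w -> 0 < e ->
  exists v w', [/\ `|v - z| < e,
    cone [set v - p | p in metric_proj C v] w' & `|w' - w| < e].
Proof.
move=> cC [Cz wN] e0.
have e4 : 0 < e / 4 by rewrite divr_gt0.
have /nbhs_normP[d /= d0 wd] := wN _ e4.
(* With k + 1 in the denominator, t k stays below both e and d, including when
   w = 0. *)
pose k : R := (1 + 2 * N%:R) * `|w|.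
have N0 : 0 <= N%:R :> R by [].
have w0 : 0 <= `|w| by [].
have k0 : 0 <= k by rewrite mulr_ge0// addr_ge0// mulr_ge0.
pose t : R := Num.min e d / (1 + k).
have k1 : 0 < 1 + k by rewrite ltr_pwDl.
have t0 : 0 < t by rewrite divr_gt0// lt_min e0.
have tk : t * k < Num.min e d.
  rewrite /t mulrAC ltr_pdivrMr// ltr_pM2l ?lt_min ?e0//.
  by rewrite ltrDr.
have /andP[tke tkd] : (t * k < e) && (t * k < d) by rewrite -lt_min.
have [p pP] := metric_proj_neq0 (z + t *: w) cC (ex_intro _ z Cz).
have Cp : C p by case: pP.
pose h := p - z.
have hh := metric_proj_shift (ltW t0) Cz pP.
have {}hh : enorm h ^+ 2 <= 2 * t * dotp w h by rewrite sqr_enorm.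
have wh : dotp w h <= N%:R * `|w| * enorm h.
  apply: le_trans (ler_norm _) _; apply: le_trans (normr_dotp_le _ _) _.
  by rewrite -mulrA ler_wpM2l// ler_wpM2l// norm_le_enorm.
have h1 : enorm h <= 2 * t * (N%:R * `|w|).
  apply: le_of_sqr_le; first by apply: mulr_ge0; apply: mulr_ge0 => //; exact: ltW.
  by apply: le_trans hh _; rewrite -[leRHS]mulrA ler_wpM2l// mulr_ge0// ltW.
have hd : `|h| < d.
  apply: le_lt_trans (norm_le_enorm _) _; apply: le_lt_trans h1 _.
  apply: le_lt_trans tkd; rewrite /k.
  have := mulr_ge0 (ltW t0) w0; by nra.
have wh' : dotp w h <= e / 4 * enorm h.
  apply: wd Cp; rewrite /= distrC; exact: hd.
have h2 : enorm h <= t * (e / 2).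
  apply: le_of_sqr_le.
    by apply: mulr_ge0; [exact: ltW | apply: divr_ge0 => //; exact: ltW].
  apply: le_trans hh _.
  have := ler_wpM2l (ltW t0) wh'; by nra.
exists (z + t *: w), (t^-1 *: (z + t *: w - p)); split.
- rewrite addrAC subrr add0r normrZ gtr0_norm//.
  apply: le_lt_trans tke; rewrite ler_wpM2l// ?(ltW t0)// /k ler_peMl//.
  by rewrite lerDl mulr_ge0.
- exists t^-1; first by rewrite invr_ge0 ltW.
  by exists (z + t *: w - p) => //; exists p.
- have -> : t^-1 *: (z + t *: w - p) - w = - (t^-1 *: h).
    have -> : z + t *: w - p = t *: w - h by rewrite /h opprB [RHS]addrCA addrA.
    by rewrite scalerBr scalerA mulVf ?gt_eqF// scale1r addrC addrA addNr add0r.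
  rewrite normrN normrZ gtr0_norm ?invr_gt0// ltr_pdivrMl//.
  apply: le_lt_trans (norm_le_enorm _) _; apply: le_lt_trans h2 _.
  by rewrite ltr_pM2l// ltr_pdivrMr// ltr_pMr// ltr1n.
Qed.

(** A diagonal argument: replace the j-th regular normal by a proximal normal
    within 1 / (j + 1) of it, and likewise for the base points. *)
Lemma limiting_normal_lim C z w (zs ws : nat -> 'rV[R]_N) : closed C -> C z ->
  zs j @[j --> \oo] --> z -> ws j @[j --> \oo] --> w ->
  (forall j, frechet_normal C (zs j) (ws j)) -> limiting_normal C z w.
Proof.
move=> cC Cz zsz wsw wsN; split=> //.
have /choice[vw vwP] j : exists vw : 'rV[R]_N * 'rV[R]_N,
    [/\ `|vw.1 - zs j| < j.+1%:R^-1,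
     cone [set vw.1 - p | p in metric_proj C vw.1] vw.2 &
     `|vw.2 - ws j| < j.+1%:R^-1].
  have [|v [w' P]] := frechet_normal_proximal (e := j.+1%:R^-1) cC (wsN j).
    by rewrite invr_gt0.
  by exists (v, w').
exists (fun j => (vw j).1), (fun j => (vw j).2); split=> [|j|].
- by apply: cvg_of_close zsz _ => j; case: (vwP j).
- by case: (vwP j).
- by apply: cvg_of_close wsw _ => j; case: (vwP j).
Qed.

Lemma limiting_normal0 C z : C z -> limiting_normal C z 0.
Proof.
move=> Cz; split=> //; exists (fun=> z), (fun=> 0); split=> [|_|];
  [exact: cvg_cst| |exact: cvg_cst].
exists 0 => //; exists 0; last by rewrite scaler0.
exists z; last by rewrite subrr.
by split=> // w _; rewrite subrr enorm0 enorm_ge0.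
Qed.

End FrechetNormal.

(** * Regular subgradients as first-order minorants *)

Section RegularSubdifferential.
Context {R : realType} {N : nat}.

(** The inequality is tested against every real upper bound a of h u, so that
    points where h is infinite satisfy it vacuously. *)
Lemma regular_subdiff_minorant (h : 'rV[R]_N -> \bar R) xb v (r e : R) :
  (forall u, h u != -oo%E) -> h xb = r%:E -> regular_subdiff h xb v -> 0 < e ->
  \forall u \near xb, forall a : R, (h u <= a%:E)%E ->
    r + dotp v (u - xb) - e * enorm (u - xb) <= a.
Proof.
move=> hNoo hr [_]; rewrite limf_einfE => sup0 e0.
have /ereal_sup_gt[_ [A Axb <-] eA] : ((- e)%:E <
    ereal_sup [set ereal_inf ((fun u => (h u - h xb - (dotp v (u - xb))%:E)
      * (enorm (u - xb))^-1%:E) @` V) | V in xb^'])%E.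
  by apply: lt_le_trans sup0; rewrite lte_fin oppr_lt0.
have : \forall u \near xb, u != xb -> A u by exact: Axb.
apply: filterS => u Au a hua.
have [uxb|uxb] := eqVneq u xb.
  move: hua; rewrite uxb hr lee_fin => ra.
  by rewrite subrr enorm0 mulr0 subr0 dotpC dotp0l addr0.
have nu : 0 < enorm (u - xb).
  by apply: lt_le_trans (norm_le_enorm _); rewrite normr_gt0 subr_eq0.
have := lt_le_trans eA (ereal_inf_lbound (ex_intro2 _ _ u (Au uxb) erefl)).
move: hua (hNoo u); rewrite hr; case: (h u) => [s| |]//.
rewrite lee_fin -!EFinB -EFinM lte_fin => sa _.
rewrite ltr_pdivlMr//; by nra.
Qed.

End RegularSubdifferential.

(** * Gradients of penalty terms *)

Section Differentials.
Context {R : realType}.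

Lemma is_diff_sum_fun (V W : normedModType R) n (h dh : 'I_n -> V -> W) x :
  (forall i, is_diff x (h i) (dh i)) ->
  is_diff x (fun z => \sum_i h i z) (fun z => \sum_i dh i z).
Proof.
move=> hdh; rewrite -!fct_sumE.
by elim/big_ind2 : _ => // [|f df g dg ? ?]; [exact: is_diff_cst | exact: is_diffD].
Qed.

Lemma is_diff_coord (V : normedModType R) n m (G dG : V -> 'M[R]_(n, m)) x i j :
  is_diff x G dG -> is_diff x (fun z => G z i j : R) (fun z => dG z i j : R).
Proof.
move=> GdG; have @coord : {linear 'M[R]_(n, m) -> R}.
  by exists (fun M : 'M[R]_(_, _) => M i j); do 2![eexists]; do ?[constructor];
     rewrite ?mxE// => ? *; rewrite ?mxE//; move=> ?; rewrite !mxE.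
have ccoord : continuous coord by exact: coord_continuous.
have : is_diff (G x) coord coord.
  by apply: DiffDef; [exact: linear_differentiable | exact: diff_lin].
exact: is_diff_comp.
Qed.

Lemma is_diff_dotp (V : normedModType R) m (F G dF dG : V -> 'rV[R]_m) x :
  is_diff x F dF -> is_diff x G dG ->
  is_diff x (fun z => dotp (F z) (G z))
            (fun v => dotp (F x) (dG v) + dotp (G x) (dF v)).
Proof.
move=> FdF GdG.
have -> : (fun v => dotp (F x) (dG v) + dotp (G x) (dF v)) =
    (fun v => \sum_i (F x 0 i * dG v 0 i + G x 0 i * dF v 0 i)).
  by apply/funext => v; rewrite /dotp -big_split.
apply: is_diff_sum_fun => i.
have := is_diffM (is_diff_coord 0 i FdF) (is_diff_coord 0 i GdG).
by [].
Qed.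

(** Covers both the multiplier-plus-penalty term of the augmented Lagrangian and
    the constraint violation (y = 0, a = 1/2). *)
Lemma is_diff_quadratic (V : normedModType R) m (G dG : V -> 'rV[R]_m)
    (y : 'rV[R]_m) (a : R) x :
  is_diff x G dG ->
  is_diff x (fun z => dotp y (G z) + a * enorm (G z) ^+ 2)
            (fun v => dotp (y + (2 * a) *: G x) (dG v)).
Proof.
move=> GdG.
have -> : (fun z => dotp y (G z) + a * enorm (G z) ^+ 2) =
    (fun z => dotp y (G z)) \+ a \*: (fun z => dotp (G z) (G z)).
  by apply/funext => z; rewrite /= sqr_enorm.
have -> : (fun v => dotp (y + (2 * a) *: G x) (dG v)) =
    (fun v => dotp y (dG v) + dotp (G x) 0) \+
    a \*: (fun v => dotp (G x) (dG v) + dotp (G x) (dG v)).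
  apply/funext => v /=.
  rewrite dotpDl dotpZl (dotpC _ 0) dotp0l addr0 -mulr2n.
  by rewrite /GRing.scale/=; ring.
apply: is_diffD; last by apply: is_diffZ; exact: is_diff_dotp.
exact: (is_diff_dotp (is_diff_cst y x)).
Qed.

Lemma is_diff_minorant (V : normedModType R) (F dF : V -> R) x (e : R) :
  is_diff x F dF -> 0 < e ->
  \forall z \near x, `|F z - F x - dF (z - x)| <= e * `|z - x|.
Proof.
move=> FdF e0.
have Fx : differentiable F x by [].
have /eqaddoP/(_ e e0) := diff_locally Fx.
rewrite diff_val => FE; apply/nbhs0P; apply: filterS FE => h.
rewrite -[(_ - _) h]/(F (h + x) - (F x + dF h)) [h + x]addrC opprD addrA.
by rewrite [x + h - x]addrAC subrr add0r.
Qed.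

(** The partial derivatives determine the gradient, and a differential of the
    form <w, .> takes the value w_i at the i-th basis vector. *)
Lemma gradient_is_diff N (F : 'rV[R]_N -> R) z w :
  is_diff z F (dotp w) -> gradient F z = w.
Proof.
move=> Fw; apply/rowP => i; rewrite mxE deriveE//.
by rewrite diff_val dotp_delta.
Qed.

End Differentials.

Section ConstraintResidual.
Context {R : realType} {n m : nat}.
Context (c : 'rV[R]_n -> 'rV[R]_m)
  (c_diff : forall x, differentiable c x).

(** A and B are general linear maps because the variables x and s sit in
    different blocks of (x, s) and of ((x, alpha), s). *)
Lemma is_diff_residual (V : normedModType R) (A : {linear V -> 'rV[R]_n})
    (B : {linear V -> 'rV[R]_m}) (z : V) : continuous A -> continuous B ->
  is_diff z (fun u => c (A u) - B u)
            (fun v => A v *m jacobian c (A z) - B v).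
Proof.
move=> Ac Bc.
have is_diff_lin (W : normedModType R) (L : {linear V -> W}) :
    continuous L -> is_diff z L L.
  by move=> Lc; apply: DiffDef; [exact: linear_differentiable | exact: diff_lin].
have cA : is_diff (A z) c (mulmxr (jacobian c (A z))).
  by apply: DiffDef => //; apply/funext => v; rewrite /= /jacobian mul_rV_lin1.
have := is_diff_comp (is_diff_lin _ A Ac) cA.
move=> /is_diffB; apply; exact: is_diff_lin.
Qed.

Lemma is_diff_residual_blocks (z : 'rV[R]_(n + m)) :
  is_diff z (fun u => c (lsubmx u) - rsubmx u)
            (fun v => lsubmx v *m jacobian c (lsubmx z) - rsubmx v).
Proof.
by apply: is_diff_residual; [exact: continuous_lsubmx | exact: continuous_rsubmx].
Qed.

Lemma dotp_residual (p : 'rV[R]_m) (J : 'M[R]_(n, m)) v :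
  dotp p (lsubmx v *m J - rsubmx v) = dotp (row_mx (p *m J^T) (- p)) v.
Proof.
by rewrite dotp_hsub dotpDr dotpNr dotpNl dotp_mulmx.
Qed.

Lemma gradient_violation (z : 'rV[R]_(n + m)) :
  let r := c (lsubmx z) - rsubmx z in
  gradient (violation c) z = row_mx (r *m (jacobian c (lsubmx z))^T) (- r).
Proof.
move=> r; apply: gradient_is_diff.
have := is_diff_quadratic 0 2^-1 (is_diff_residual_blocks z).
rewrite add0r divff// scale1r.
under [X in is_diff _ _ X]eq_fun do rewrite dotp_residual.
by under [X in is_diff _ X]eq_fun do rewrite dotp0l add0r.
Qed.

Lemma gradient_epi_violation (z : 'rV[R]_(n + 1 + m)) :
  let x := lsubmx (lsubmx z) in let r := c x - rsubmx z in
  gradient (epi_violation c) z =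
  row_mx (row_mx (r *m (jacobian c x)^T) 0) (- r).
Proof.
move=> x r; apply: gradient_is_diff.
have rz : is_diff z (fun u => c (lsubmx (lsubmx u)) - rsubmx u)
    (fun v => lsubmx (lsubmx v) *m jacobian c x - rsubmx v).
  apply: (@is_diff_residual _ (lsubmx \o lsubmx) rsubmx).
    by move=> u; apply: continuous_comp; exact: continuous_lsubmx.
  exact: continuous_rsubmx.
have := is_diff_quadratic 0 2^-1 rz.
rewrite add0r divff// scale1r.
have E v : dotp r (lsubmx (lsubmx v) *m jacobian c x - rsubmx v) =
    dotp (row_mx (row_mx (r *m (jacobian c x)^T) 0) (- r)) v.
  by rewrite !dotp_hsub dotp0l addr0 dotpDr dotpNr dotpNl dotp_mulmx.
under [X in is_diff _ _ X]eq_fun do rewrite E.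
by under [X in is_diff _ X]eq_fun do rewrite dotp0l add0r.
Qed.

End ConstraintResidual.

(** * Regular subgradients of the augmented Lagrangian *)

Section ProductSubgradient.
Context {R : realType} {n m : nat}.
Context (q : 'rV[R]_n -> \bar R) (D : set 'rV[R]_m)
  (q_gtNy : forall x, q x != -oo%E).
Implicit Types (z w v : 'rV[R]_(n + m)).

(** The regular subgradients at z = (x, s) of the extended-valued function
    q x + delta_D s; a ranges over the real upper bounds of q, as in
    [regular_subdiff_minorant]. *)
Definition frechet_subgradient z w : Prop :=
  [/\ D (rsubmx z), q (lsubmx z) \is a fin_num &
   forall e : R, 0 < e -> \forall u \near z,
     forall a : R, D (rsubmx u) -> (q (lsubmx u) <= a%:E)%E ->
     fine (q (lsubmx z)) + dotp w (u - z) - e * enorm (u - z) <= a].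

Lemma aug_lagrangian_fin c (mu : R) y z :
  aug_lagrangian q c D mu y z \is a fin_num ->
  D (rsubmx z) /\ q (lsubmx z) \is a fin_num.
Proof.
rewrite /aug_lagrangian /indicator.
case: ifPn => [/set_mem Dz|_]; move: (q_gtNy (lsubmx z)).
  by rewrite adde0; case: (q _).
by case: (q _).
Qed.

Lemma aug_lagrangianE c (mu : R) y z : D (rsubmx z) ->
  aug_lagrangian q c D mu y z =
  (q (lsubmx z) + (dotp y (c (lsubmx z) - rsubmx z)
    + (2 * mu)^-1 * enorm (c (lsubmx z) - rsubmx z) ^+ 2)%:E)%E.
Proof.
by move=> Dz; rewrite /aug_lagrangian /indicator mem_set// adde0.
Qed.

Lemma aug_lagrangian_gtNy c (mu : R) y z :
  aug_lagrangian q c D mu y z != -oo%E.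
Proof.
rewrite /aug_lagrangian /indicator.
by case: ifPn => _; move: (q_gtNy (lsubmx z)); case: (q _).
Qed.

(** Sum rule: the augmented Lagrangian is q + delta_D plus a differentiable term,
    whose gradient is subtracted.  The vector p is the updated multiplier of the
    method, evaluated at the point z. *)
Lemma regular_subdiff_aug_lagrangian c (mu : R) y z v :
  (forall x, differentiable c x) ->
  regular_subdiff (aug_lagrangian q c D mu y) z v ->
  let p := y + mu^-1 *: (c (lsubmx z) - rsubmx z) in
  frechet_subgradient z (v - row_mx (p *m (jacobian c (lsubmx z))^T) (- p)).
Proof.
move=> c_diff vz p.
have Lz : aug_lagrangian q c D mu y z \is a fin_num.
  by rewrite fin_numE aug_lagrangian_gtNy /= -ltey; case: vz.
have [Dz qz] := aug_lagrangian_fin Lz.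
split=> // e e0.
have e20 : 0 < e / 2 by rewrite divr_gt0.
have := regular_subdiff_minorant (@aug_lagrangian_gtNy c mu y)
  (esym (fineK Lz)) vz e20.
have := is_diff_minorant (is_diff_quadratic y (2 * mu)^-1
  (is_diff_residual_blocks c_diff z)) e20.
apply: filterS2 => u /= phi_le Lu a Du qua.
move: phi_le Lu; rewrite !aug_lagrangianE//.
set phiu := (_ + _ * enorm (c (lsubmx u) - _) ^+ 2).
set phiz := (_ + _ * enorm (c (lsubmx z) - _) ^+ 2).
have -> : 2 / (2 * mu) = mu^-1 by rewrite invfM mulrA divff// mul1r.
have qu : (q (lsubmx u) + phiu%:E <= (a + phiu)%:E)%E by rewrite (EFinD a) leeD2r.
rewrite dotp_residual -/p fineD//= => phi_le /(_ _ qu) Lu.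
rewrite dotpDl dotpNl.
have := ler_wpM2l (ltW e20) (norm_le_enorm (u - z)).
move: (le_trans (ler_norm _) phi_le) Lu.
set g := dotp (row_mx _ _) _; lra.
Qed.

(** On the epigraph alpha' >= q x', so the minorant of q bounds alpha' itself;
    moving alpha' to the other side gives the component -1. *)
Lemma frechet_subgradient_epi z w : frechet_subgradient z w ->
  frechet_normal (setprod_rv (epi q) D)
    (row_mx (row_mx (lsubmx z) (fine (q (lsubmx z)))%:M) (rsubmx z))
    (row_mx (row_mx (lsubmx w) (-1)%:M) (rsubmx w)).
Proof.
move=> [Dz qz wz]; split.
  split; rewrite /= ?row_mxKl ?row_mxKr//.
  by rewrite /epi/= row_mxKl row_mxKr mxE/= mulr1n fineK.
move=> e e0.
pose Z := row_mx (row_mx (lsubmx z) (fine (q (lsubmx z)))%:M) (rsubmx z).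
rewrite -/Z.
pose proj (U : 'rV[R]_(n + 1 + m)) := row_mx (lsubmx (lsubmx U)) (rsubmx U).
have proj_cvg : proj U @[U --> Z] --> z.
  have -> : z = proj Z by rewrite /proj /Z !row_mxKl row_mxKr hsubmxK.
  apply: (@cvg_row_mx _ _ (nbhs Z)); last exact: continuous_rsubmx.
  exact: (continuous_comp (@continuous_lsubmx _ _ _ _ Z) (@continuous_lsubmx _ _ _ _ _)).
have := proj_cvg _ (wz e e0); apply: (@filterS _ (nbhs Z)) => U /= projU [qU DU].
have := projU (rsubmx (lsubmx U) 0 0).
rewrite /proj row_mxKl row_mxKr => /(_ DU qU).
set x := lsubmx (lsubmx U); set a := rsubmx (lsubmx U) 0 0.
set s := rsubmx U => le_a.
have UE : U - Z = row_mx (row_mx (x - lsubmx z)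
    (rsubmx (lsubmx U) - (fine (q (lsubmx z)))%:M)) (s - rsubmx z).
  rewrite -{1}[U]hsubmxK -{1}[lsubmx U]hsubmxK /Z.
  by rewrite !opp_row_mx !add_row_mx.
have uE : row_mx x s - z = row_mx (x - lsubmx z) (s - rsubmx z).
  by rewrite -{1}[z]hsubmxK opp_row_mx add_row_mx.
have alphaE : dotp (-1)%:M (rsubmx (lsubmx U) - (fine (q (lsubmx z)))%:M)
    = fine (q (lsubmx z)) - a.
  rewrite [rsubmx (lsubmx U)]mx11_scalar -raddfB /dotp big_ord1 !mxE/= !mulr1n.
  by rewrite mulN1r opprB /a !mxE.
have le_enormU : enorm (row_mx x s - z) <= enorm (U - Z).
  by rewrite le_enorm uE UE !dotp_row_mx lerD2r lerDl dotp_ge0.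
have := ler_wpM2l (ltW e0) le_enormU.
move: le_a; rewrite uE -{1}[w]hsubmxK UE !dotp_row_mx alphaE; lra.
Qed.

(** Freeze x in the minorant: what remains constrains only the s-component, and
    the whole space contributes the normal 0 in x. *)
Lemma frechet_subgradient_prodT z w : frechet_subgradient z w ->
  frechet_normal (setprod_rv setT D) z (row_mx 0 (rsubmx w)).
Proof.
move=> [Dz qz wz]; split=> // e e0.
have slice_cvg : row_mx (lsubmx z) (rsubmx u) @[u --> z] -->
    row_mx (lsubmx z) (rsubmx z).
  by apply: (@cvg_row_mx _ _ (nbhs z)); [exact: cvg_cst | exact: continuous_rsubmx].
rewrite hsubmxK in slice_cvg.
have := slice_cvg _ (wz e e0); apply: (@filterS _ (nbhs z)) => u /= slice_u [_ Du].
have := slice_u (fine (q (lsubmx z))).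
rewrite row_mxKl row_mxKr fineK// => /(_ Du (lexx _)).
have -> : row_mx (lsubmx z) (rsubmx u) - z = row_mx 0 (rsubmx (u - z)).
  by rewrite -{2}[z]hsubmxK opp_row_mx add_row_mx subrr linearB.
rewrite (dotpC w) !dotp_hsub !dotp0l !add0r enorm_row_0mx (dotpC (rsubmx (u - z))).
have enu : enorm (rsubmx (u - z)) <= enorm (u - z).
  rewrite le_enorm -[in leRHS](hsubmxK (u - z)) dotp_row_mx lerDr.
  exact: dotp_ge0.
have := ler_wpM2l (ltW e0) enu; lra.
Qed.

(** Move from z by k w_x in the x-block only, with w_x the x-component of w and
    s kept in D: the minorant forces growth at least k (|w_x|^2 - |w_x|), the
    Lipschitz bound allows at most k M |w_x|. *)
Lemma frechet_subgradient_lipschitz z w (M : R) :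
  0 <= M -> frechet_subgradient z w ->
  (\forall x \near lsubmx z, q x \is a fin_num /\
     `|fine (q x) - fine (q (lsubmx z))| <= M * `|x - lsubmx z|) ->
  `|lsubmx w| <= M + 1.
Proof.
move=> M0 [Dz qz wz] qM.
pose d : 'rV[R]_(n + m) := row_mx (lsubmx w) 0.
have [e /= e0 near_e] : \forall k \near (0 : R),
    [/\ q (lsubmx z + k *: lsubmx w) \is a fin_num,
     `|fine (q (lsubmx z + k *: lsubmx w)) - fine (q (lsubmx z))|
       <= M * `|k *: lsubmx w| &
     forall a : R, (q (lsubmx z + k *: lsubmx w) <= a%:E)%E ->
       fine (q (lsubmx z)) + dotp w (k *: d) - enorm (k *: d) <= a].
  have /nbhs0P/(near0Z (lsubmx w)) := qM.
  have /nbhs0P/(near0Z d) := wz 1 ltr01.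
  apply: filterS2 => k wk [qk Mk]; split=> //.
    by move: Mk; rewrite addrAC subrr add0r.
  move=> a qa; have := wk a.
  have -> : z + k *: d - z = k *: d by rewrite addrAC subrr add0r.
  rewrite mul1r !linearD !linearZ /= row_mxKl row_mxKr.
  by rewrite scaler0 addr0 => /(_ Dz qa).
pose k := e / 2.
have k0 : 0 < k by rewrite divr_gt0.
have [] := near_e k.
  by rewrite /= sub0r normrN gtr0_norm// ltr_pdivrMr// ltr_pMr// ltr1n.
move=> qk Mk; move=> /(_ (fine (q (lsubmx z + k *: lsubmx w)))).
rewrite fineK// => /(_ (lexx _)).
rewrite dotpZr enormZ gtr0_norm// (dotpC w) dotp_hsub dotp0l addr0 enorm_row_mx0.
rewrite -sqr_enorm => le_q; move: (le_trans (ler_norm _) Mk).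
rewrite normrZ gtr0_norm// => {}Mk.
apply: le_trans (norm_le_enorm _) _.
apply: le_of_sqr_le; first by rewrite addr_ge0.
rewrite -(ler_pM2l k0).
have := ler_wpM2l (mulr_ge0 M0 (ltW k0)) (norm_le_enorm (lsubmx w)).
lra.
Qed.

End ProductSubgradient.

(** * Closedness of epigraphs and products *)

Section Semicontinuity.
Context {R : realType}.

Lemma lte_dense_fin (a : R) (y : \bar R) :
  (a%:E < y)%E -> exists2 b : R, a < b & (b%:E < y)%E.
Proof.
case: y => [r| _ |]//; last by exists (a + 1); rewrite ?ltrDl ?ltry.
rewrite lte_fin => ar; exists ((a + r) / 2); first exact: (midf_lt ar).1.
by rewrite lte_fin; exact: (midf_lt ar).2.
Qed.

(** Split a as (a - b) + b with a - f x < b < g x, then use openness on each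
    summand. *)
Lemma lower_semicontinuousD (X : topologicalType) (f : X -> R)
    (g : X -> \bar R) :
  continuous f -> lower_semicontinuous g ->
  lower_semicontinuous (fun u => (f u)%:E + g u)%E.
Proof.
move=> f_cont g_lsc x a afg.
have /lte_dense_fin[b ab bg] : ((a - f x)%:E < g x)%E.
  by rewrite EFinB lteBlDl// .
have [V xV Vg] := g_lsc _ _ bg.
have fV : \forall u \near x, a - b < f u.
  by apply: (cvgr_gt (f x) (f_cont x)); lra.
exists (V `&` [set u | a - b < f u]); first exact: filterI.
move=> u [/Vg bgu /= fu]; rewrite -[a](subrK b) EFinD.
by rewrite lteD.
Qed.

(** A real b strictly between alpha and h x separates a whole neighbourhood of
    (x, alpha) from the epigraph. *)
Lemma closed_epi N (h : 'rV[R]_N -> \bar R) :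
  lower_semicontinuous h -> closed (epi h).
Proof.
move=> h_lsc; rewrite -openC openE => z /= /negP; rewrite -ltNge.
move=> /lte_dense_fin[b ab bh]; have [V xV Vh] := h_lsc _ _ bh.
have nV : \forall u \near z, V (lsubmx u) by exact: continuous_lsubmx.
have nb : \forall u \near z, rsubmx u 0 0 < b.
  have : rsubmx u 0 0 @[u --> z] --> rsubmx z 0 0.
    by apply: (@cvg_coord _ _ (nbhs z)); exact: continuous_rsubmx.
  by move/cvgr_lt; apply.
apply: filterS2 nV nb => u /Vh bhu ub /=; apply/negP; rewrite -ltNge.
by apply: lt_trans bhu; rewrite lte_fin.
Qed.

Lemma closed_setprod_rv n m (A : set 'rV[R]_n) (B : set 'rV[R]_m) :
  closed A -> closed B -> closed (setprod_rv A B).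
Proof.
move=> cA cB; apply: closedI.
  by apply: closed_comp cA => z _; exact: continuous_lsubmx.
by apply: closed_comp cB => z _; exact: continuous_rsubmx.
Qed.

End Semicontinuity.

(** * Penalty parameters of the method *)

Section PenaltyDichotomy.
Context {R : realType}.

Lemma cvg_contraction (u : nat -> R) (theta : R) k0 :
  0 <= theta < 1 -> (forall k, 0 <= u k) ->
  (forall k, (k0 <= k)%N -> u k.+1 <= theta * u k) ->
  u k @[k --> \oo] --> 0.
Proof.
move=> /andP[theta0 theta1] u0 uS.
have ub j : u (j + k0)%N <= geometric (u k0) theta j.
  elim: j => [|j IH]; first by rewrite /= expr0 mulr1.
  rewrite addSn; apply: le_trans (uS _ (leq_addl _ _)) _.
  by rewrite /= exprS mulrCA ler_wpM2l.
rewrite -(cvg_shiftn k0).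
apply: (@squeeze_cvgr _ _ _ _ (fun=> 0) (geometric (u k0) theta)).
- by apply: nearW => j; rewrite u0 ub.
- exact: cvg_cst.
- by apply: cvg_geometric; rewrite ger0_norm.
Qed.

(** A nonnegative nonincreasing sequence that is infinitely often multiplied by
    at most kappa < 1 falls below every u_0 kappa^N. *)
Lemma cvg_frequent_contraction (u : nat -> R) (kappa : R) :
  0 <= kappa < 1 -> (forall k, 0 <= u k) ->
  (forall k, u k.+1 <= u k) ->
  (forall k0, exists2 k, (k0 <= k)%N & u k.+1 <= kappa * u k) ->
  u k @[k --> \oo] --> 0.
Proof.
move=> /andP[kappa0 kappa1] u0 uS uk.
have u_noninc i j : (i <= j)%N -> u j <= u i.
  by move=> ij; move/nonincreasing_seqP : uS => /(_ i j ij).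
have small N : exists k, u k <= geometric (u 0%N) kappa N.
  elim: N => [|N [k0 uk0]]; first by exists 0%N; rewrite /= expr0 mulr1.
  have [k k0k uSk] := uk k0; exists k.+1; apply: le_trans uSk _.
  rewrite /= exprS mulrCA ler_wpM2l//.
  by apply: le_trans (u_noninc _ _ k0k) uk0.
have geo0 : geometric (u 0%N) kappa N @[N --> \oo] --> 0.
  by apply: cvg_geometric; rewrite ger0_norm.
apply/cvgrPdist_lt => e e0.
have /cvgrPdist_lt/(_ e e0)[N _ /(_ N (leqnn N)) /=] := geo0.
rewrite sub0r normrN => geoN; have [k uk_le] := small N.
exists k => // j kj /=; rewrite sub0r normrN ger0_norm//.
apply: le_lt_trans (u_noninc _ _ kj) _; apply: le_lt_trans uk_le _.
exact: le_lt_trans (ler_norm _) geoN.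
Qed.

Context {n m : nat} (q : 'rV[R]_n -> \bar R) (c : 'rV[R]_n -> 'rV[R]_m).
Context (D : set 'rV[R]_m) (mu0 theta kappa : R) (Y : set 'rV[R]_m).
Context (mu eps : nat -> R) (yhat y : nat -> 'rV[R]_m).
Context (x : nat -> 'rV[R]_n) (s : nat -> 'rV[R]_m).
Context (run : alm_run q c D mu0 theta kappa Y mu eps yhat y x s).
Context (mu0_gt0 : 0 < mu0) (theta_itv : 0 < theta < 1).
Context (kappa_itv : 0 < kappa < 1).

Lemma alm_mu_gt0 k : 0 < mu k.
Proof.
elim: k => [|k IH]; first by rewrite (alm_mu0 run).
by have := alm_mu run k; case: ifP => [_ ->//|_ /andP[]].
Qed.

(** Either the penalty parameter is eventually kept, and then every step
    contracts the residual by theta; or it is reduced infinitely often, each time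
    by the factor kappa or a smaller one. *)
Lemma alm_dichotomy :
  mu k @[k --> \oo] --> 0 \/ enorm (c (x k) - s k) @[k --> \oo] --> 0.
Proof.
have /andP[theta0 theta1] := theta_itv; have /andP[kappa0 kappa1] := kappa_itv.
pose accepted k := (k == 0%N) ||
  (enorm (c (x k) - s k) <= theta * enorm (c (x k.-1) - s k.-1)).
have mu_step k : if accepted k then mu k.+1 = mu k
  else 0 < mu k.+1 <= kappa * mu k by exact: alm_mu run k.
have [[k0 acc]|rej] := pselect (exists k0, forall k, (k0 <= k)%N -> accepted k).
  right; apply: (@cvg_contraction _ theta k0) => [|k|k k0k].
  - by rewrite (ltW theta0).
  - exact: enorm_ge0.
  - exact: acc k.+1 (leqW k0k).
left; apply: (@cvg_frequent_contraction _ kappa) => [|k|k|k0].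
- by rewrite (ltW kappa0).
- exact: ltW (alm_mu_gt0 k).
- have := mu_step k; case: ifP => [_ ->//|_ /andP[_ le_mu]].
  by apply: le_trans le_mu _; rewrite ler_piMl ?(ltW kappa1) ?(ltW (alm_mu_gt0 k)).
- have [k [k0k nacc]] : exists k, (k0 <= k)%N /\ ~~ accepted k.
    apply: contrapT => nex; apply: rej; exists k0 => k k0k.
    by apply: contrapT => /negP nacc; apply: nex; exists k.
  exists k => //; have := mu_step k; rewrite (negbTE nacc).
  by case/andP.
Qed.

End PenaltyDichotomy.

(** * Passage to the limit *)

Section LimitingStationarity.
Context {R : realType} {n m : nat}.
Context (q : 'rV[R]_n -> \bar R) (q_gtNy : forall x, q x != -oo%E).
Context (D : set 'rV[R]_m).

(** The convergence of the values in the definition of a limiting subgradient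
    transfers from the augmented Lagrangian to q, because the rest of it is
    continuous on its domain. *)
Lemma limiting_subdiff_aug_lagrangian (c : 'rV[R]_n -> 'rV[R]_m) (mu : R) y
    (zb eta : 'rV[R]_(n + m)) (e : R) :
  (forall x, differentiable c x) -> 0 < e ->
  limiting_subdiff (aug_lagrangian q c D mu y) zb eta ->
  exists z v, [/\ regular_subdiff (aug_lagrangian q c D mu y) z v,
    `|z - zb| < e, `|fine (q (lsubmx z)) - fine (q (lsubmx zb))| < e &
    `|v - eta| < 1].
Proof.
move=> c_diff e0 [zb_dom [zs [vs [zs_cvg Lzs vs_reg vs_cvg]]]].
have Lfin z : edom (aug_lagrangian q c D mu y) z ->
    aug_lagrangian q c D mu y z \is a fin_num.
  by move=> zdom; rewrite fin_numE aug_lagrangian_gtNy// -ltey.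
have Lb := Lfin _ zb_dom.
pose phi (z : 'rV[R]_(n + m)) := dotp y (c (lsubmx z) - rsubmx z)
  + (2 * mu)^-1 * enorm (c (lsubmx z) - rsubmx z) ^+ 2.
have phi_cvg : phi (zs j) @[j --> \oo] --> phi zb.
  have phi_diff := is_diff_quadratic y (2 * mu)^-1 (is_diff_residual_blocks c_diff zb).
  apply: (cvg_comp _ _ zs_cvg).
  by apply: differentiable_continuous; exact: ex_diff.
have qE z : aug_lagrangian q c D mu y z \is a fin_num ->
    fine (q (lsubmx z)) = fine (aug_lagrangian q c D mu y z) - phi z.
  move=> Lz; have [Dz qz] := aug_lagrangian_fin q_gtNy Lz.
  by rewrite aug_lagrangianE// fineD//= addrK.
have q_cvg : fine (q (lsubmx (zs j))) @[j --> \oo] --> fine (q (lsubmx zb)).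
  rewrite qE//.
  under eq_fun => j.
    rewrite qE; last by apply: Lfin; case: (vs_reg j).
    over.
  apply: cvgB => //; apply: fine_cvg; rewrite fineK//.
have near_z : \forall j \near \oo, `|zs j - zb| < e.
  by move/cvgr_distC_lt : zs_cvg; apply.
have near_q : \forall j \near \oo,
    `|fine (q (lsubmx (zs j))) - fine (q (lsubmx zb))| < e.
  by move/cvgr_distC_lt : q_cvg; apply.
have near_v : \forall j \near \oo, `|vs j - eta| < 1.
  by move/cvgr_distC_lt : vs_cvg; apply.
have [j [zj qj vj]] : exists j, [/\ `|zs j - zb| < e,
    `|fine (q (lsubmx (zs j))) - fine (q (lsubmx zb))| < e & `|vs j - eta| < 1].
  apply: (@filter_ex _ \oo).
  by near=> j; split; near: j.
by exists (zs j), (vs j).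
Unshelve. all: by end_near. Qed.

Context (zs ws : nat -> 'rV[R]_(n + m)) (mus : nat -> R).
Context (xs gx : 'rV[R]_n) (ss gs : 'rV[R]_m).
Context (zs_cvg : zs j @[j --> \oo] --> row_mx xs ss).
Context (q_cvg : fine (q (lsubmx (zs j))) @[j --> \oo] --> fine (q xs)).
Context (mus_gt0 : forall j, 0 < mus j) (mus_cvg : mus j @[j --> \oo] --> 0).
Context (ws_sub : forall j, frechet_subgradient q D (zs j) (ws j)).
Context (ws_cvg : mus j *: ws j @[j --> \oo] --> row_mx gx gs).
Context (D_closed : closed D).

Lemma cvg_scaled_lsubmx : mus j *: lsubmx (ws j) @[j --> \oo] --> gx.
Proof.
have -> : (fun j => mus j *: lsubmx (ws j)) = (fun j => lsubmx (mus j *: ws j)).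
  by apply/funext => j; rewrite linearZ.
exact: (cvg_lsubmx ws_cvg).
Qed.

Lemma cvg_scaled_rsubmx : mus j *: rsubmx (ws j) @[j --> \oo] --> gs.
Proof.
have -> : (fun j => mus j *: rsubmx (ws j)) = (fun j => rsubmx (mus j *: ws j)).
  by apply/funext => j; rewrite linearZ.
exact: (cvg_rsubmx ws_cvg).
Qed.

Lemma limit_in_D : D ss.
Proof.
apply: (closed_cvg _ D_closed _ _ (cvg_rsubmx zs_cvg)).
by apply: nearW => j; case: (ws_sub j).
Qed.

(** Multiplying the normals (w_x, -1, w_s) by the penalty parameters, which tend
    to 0, sends the epigraphical component to 0 and keeps the limit of the
    others. *)
Lemma limiting_normal_epi : closed (epi q) -> q xs \is a fin_num ->
  limiting_normal (setprod_rv (epi q) D)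
    (row_mx (row_mx xs (fine (q xs))%:M) ss) (row_mx (row_mx gx 0) gs).
Proof.
move=> epi_closed q_fin.
apply: (@limiting_normal_lim _ _ _ _ _
  (fun j => row_mx (row_mx (lsubmx (zs j)) (fine (q (lsubmx (zs j))))%:M)
                   (rsubmx (zs j)))
  (fun j => mus j *: row_mx (row_mx (lsubmx (ws j)) (-1)%:M) (rsubmx (ws j)))).
- exact: closed_setprod_rv.
- split; rewrite ?row_mxKl ?row_mxKr; last exact: limit_in_D.
  by rewrite /epi/= row_mxKl row_mxKr mxE/= mulr1n fineK.
- apply: (@cvg_row_mx _ _ \oo) _ (cvg_rsubmx zs_cvg).
  apply: (@cvg_row_mx _ _ \oo) (cvg_lsubmx zs_cvg) _.
  exact: (@cvg_scalar_mx11 _ _ \oo).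
- under eq_fun do rewrite !scale_row_mx scale_scalar_mx mulrN1.
  apply: (@cvg_row_mx _ _ \oo) _ cvg_scaled_rsubmx.
  apply: (@cvg_row_mx _ _ \oo) cvg_scaled_lsubmx _.
  have -> : (0 : 'M[R]_1) = 0%:M by rewrite raddf0.
  by apply: (@cvg_scalar_mx11 _ _ \oo); rewrite -oppr0; exact: cvgN.
- by move=> j; apply: frechet_normalZ; [exact: ltW | exact: frechet_subgradient_epi].
Qed.

(** Near xs the x-components of the subgradients are bounded by a Lipschitz
    constant plus 1, so their products with the vanishing penalty parameters
    tend to 0. *)
Lemma limiting_normal_prodT : locally_lipschitz_ext_at q xs ->
  gx = 0 /\ limiting_normal (setprod_rv setT D) (row_mx xs ss) (row_mx 0 gs).
Proof.
move=> [q_fin q_lip]; split.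
  (* The Lipschitz inequality holds on a neighbourhood of the pair (xs, xs), so
     it holds around every x near xs, with the same M. *)
  have [M M0 q_M] : exists2 M : R, 0 <= M & \forall x \near xs, \forall u \near x,
      q u \is a fin_num /\ `|fine (q u) - fine (q x)| <= M * `|u - x|.
    rewrite /lipschitz_on in q_lip.
    have [M [q_M M0]] := filter_ex (filterI q_lip (nbhs_pinfty_ge (num_real 0))).
    exists M => //; have [[U V] /= [xsU xsV] UV] := q_M.
    have : nbhs xs (U `&` V `&` [set u | q u \is a fin_num]).
      by apply: filterI => //; exact: filterI.
    move/nbhs_interior.
    apply: (@filterS _ (nbhs xs)) => x Ux; have [[_ Vx] _] := nbhs_singleton Ux.
    move: Ux; apply: (@filterS _ (nbhs x)) => u [[Uu _] qu].
    by split=> //; exact: (UV (u, x)).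
  have gx0 : mus j *: lsubmx (ws j) @[j --> \oo] --> (0 : 'rV[R]_n).
    apply/norm_cvg0P.
    apply: (@squeeze_cvgr _ _ _ _ (fun=> 0) (fun j => mus j * (M + 1))).
    - have : \forall j \near \oo, \forall u \near lsubmx (zs j),
          q u \is a fin_num /\
          `|fine (q u) - fine (q (lsubmx (zs j)))| <= M * `|u - lsubmx (zs j)|.
        exact: (cvg_lsubmx zs_cvg) q_M.
      apply: filterS => j qj; rewrite normr_ge0 normrZ gtr0_norm// ler_pM2l//=.
      exact: frechet_subgradient_lipschitz qj.
    - exact: cvg_cst.
    - by rewrite -(mul0r (M + 1)); apply: cvgMr_tmp.
  exact: (cvg_unique _ cvg_scaled_lsubmx gx0).
apply: (@limiting_normal_lim _ _ _ _ _ zs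
  (fun j => mus j *: row_mx 0 (rsubmx (ws j)))) => //.
- by apply: closed_setprod_rv => //; exact: closedT.
- by split=> //=; rewrite row_mxKr; exact: limit_in_D.
- under eq_fun do rewrite scale_row_mx scaler0.
  apply: (@cvg_row_mx _ _ \oo) _ cvg_scaled_rsubmx; exact: cvg_cst.
- by move=> j; apply: frechet_normalZ; [exact: ltW | exact: frechet_subgradient_prodT].
Qed.

End LimitingStationarity.

Lemma cvg_scale_bounded {R : realType} N (a : nat -> R) (b : nat -> 'rV[R]_N)
    (B : R) :
  a j @[j --> \oo] --> 0 -> (forall j, `|b j| <= B) ->
  a j *: b j @[j --> \oo] --> (0 : 'rV[R]_N).
Proof.
move=> a0 bB; apply/norm_cvg0P.
apply: (@squeeze_cvgr _ _ _ _ (fun=> 0) (fun j => `|a j| * B)).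
- by apply: nearW => j; rewrite normr_ge0 normrZ ler_wpM2l.
- exact: cvg_cst.
- by rewrite -(mul0r B); apply: cvgMr_tmp; apply/norm_cvg0P.
Qed.

(** Multiplying by mus j turns the multiplier p j into mus j *: ys j plus the
    residual; the bounded vectors ys j and vs j disappear in the limit. *)
Lemma cvg_penalized_subgradient {R : realType} {n m : nat}
    (c : 'rV[R]_n -> 'rV[R]_m) (zs vs : nat -> 'rV[R]_(n + m))
    (ys : nat -> 'rV[R]_m) (mus : nat -> R) xs ss (B B' : R) :
  continuous c -> continuous (jacobian c) ->
  zs j @[j --> \oo] --> row_mx xs ss ->
  (forall j, 0 < mus j) -> mus j @[j --> \oo] --> 0 ->
  (forall j, `|vs j| <= B) -> (forall j, `|ys j| <= B') ->
  let p j := ys j + (mus j)^-1 *: (c (lsubmx (zs j)) - rsubmx (zs j)) in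
  mus j *: (vs j - row_mx (p j *m (jacobian c (lsubmx (zs j)))^T) (- p j))
    @[j --> \oo] -->
  row_mx (- ((c xs - ss) *m (jacobian c xs)^T)) (c xs - ss).
Proof.
move=> c_cont J_cont zs_cvg mus_gt0 mus0 vsB ysB p.
have lz : lsubmx (zs j) @[j --> \oo] --> xs by exact: (cvg_lsubmx zs_cvg).
have rz : rsubmx (zs j) @[j --> \oo] --> ss by exact: (cvg_rsubmx zs_cvg).
pose mp j := mus j *: ys j + (c (lsubmx (zs j)) - rsubmx (zs j)).
have mp_cvg : mp j @[j --> \oo] --> c xs - ss.
  rewrite -[c xs - ss]add0r; apply: cvgD; first exact: cvg_scale_bounded mus0 ysB.
  apply: cvgB; last exact: rz.
  by apply: (cvg_comp _ _ lz); exact: c_cont.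
have Jz : jacobian c (lsubmx (zs j)) @[j --> \oo] --> jacobian c xs.
  by apply: (cvg_comp _ _ lz); exact: J_cont.
have -> : (fun j => mus j *: (vs j
      - row_mx (p j *m (jacobian c (lsubmx (zs j)))^T) (- p j))) =
    (fun j => mus j *: vs j
      + row_mx (- (mp j *m (jacobian c (lsubmx (zs j)))^T)) (mp j)).
  apply/funext => j; rewrite scalerBr -scalerN opp_row_mx opprK scale_row_mx.
  have -> : mp j = mus j *: p j.
    by rewrite scalerDr scalerA divff ?gt_eqF// scale1r.
  by rewrite scalerN scalemxAl.
rewrite -[row_mx _ _ in X in _ --> X]add0r.
apply: cvgD; first exact: cvg_scale_bounded mus0 vsB.
apply: (@cvg_row_mx _ _ \oo) => //; apply: cvgN.
exact: cvg_mulmx_tr mp_cvg Jz.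
Qed.

(** * Stationarity of accumulation points *)

Theorem proposition3p6 (R : realType) (n m : nat)
    (f : 'rV[R]_n -> R) (g : 'rV[R]_n -> \bar R)
    (c : 'rV[R]_n -> 'rV[R]_m) (D : set 'rV[R]_m)
    (f_diff : forall x, differentiable f x)
    (f_C1 : continuous (gradient f))
    (f_lip : locally_lipschitz (gradient f))
    (c_diff : forall x, differentiable c x)
    (c_C1 : continuous (jacobian c))
    (c_lip : locally_lipschitz (jacobian c))
    (g_proper : proper_ext g) (g_lsc : lower_semicontinuous g)
    (g_prox : prox_bounded g)
    (D_nonempty : D !=set0) (D_closed : closed D)
    (mu0 theta kappa : R) (mu0_gt0 : 0 < mu0)
    (theta_itv : 0 < theta < 1) (kappa_itv : 0 < kappa < 1)
    (Y : set 'rV[R]_m) (Y_nonempty : Y !=set0) (Y_bounded : bounded_set Y)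
    (mu eps : nat -> R) (yhat y : nat -> 'rV[R]_m)
    (x : nat -> 'rV[R]_n) (s : nat -> 'rV[R]_m) :
  let q := fun u => ((f u)%:E + g u)%E in
  alm_run q c D mu0 theta kappa Y mu eps yhat y x s ->
  bounded_fun eps ->
  forall (K : nat -> nat) (xs : 'rV[R]_n) (ss : 'rV[R]_m),
  increasing_seq K ->
  x (K j) @[j --> \oo] --> xs ->
  edom q xs ->
  q (x (K j)) @[j --> \oo] --> q xs ->
  s (K j) @[j --> \oo] --> ss ->
  M_stationary (epi_violation c) (setprod_rv (epi q) D)
    (row_mx (row_mx xs (fine (q xs))%:M) ss)
  /\
  (locally_lipschitz_ext_at q xs ->
   M_stationary (violation c) (setprod_rv setT D) (row_mx xs ss)).

Proof.
move=> q run eps_bnd K xs ss K_inc x_cvg xs_dom q_cvg s_cvg.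
have q_gtNy u : q u != -oo%E.
  by rewrite /q adde_eq_ninfty negb_or/= g_proper.1.
have c_cont : continuous c by move=> u; exact: differentiable_continuous.
have q_lsc : lower_semicontinuous q.
  by apply: lower_semicontinuousD => // u; exact: differentiable_continuous.
have q_fin : q xs \is a fin_num by rewrite fin_numE q_gtNy -ltey.
have K_cvg : K j @[j --> \oo] --> \oo.
  have leK j : (j <= K j)%N.
    elim: j => // j IH; apply: leq_ltn_trans IH _.
    by rewrite ltnNge; have := K_inc j.+1 j; rewrite ltnn leEnat => ->.
  by apply/cvgnyPge => k; exists k => // j /= kj; exact: leq_trans kj (leK j).
have [B eps_B] : exists B : R, forall k, eps k <= B.
  move: eps_bnd; rewrite /= /bounded_near => /filter_ex[B epsB]; exists B => k.
  by apply: le_trans (ler_norm _) _; exact: epsB.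
have [B' Y_B] : exists B : R, forall u, Y u -> `|u| <= B.
  move: Y_bounded; rewrite /= /bounded_near => /filter_ex[M YM].
  by exists M => u Yu; exact: YM.
have ss_D : D ss.
  apply: (closed_cvg _ D_closed _ _ s_cvg).
  by apply: nearW => j; exact: alm_feasible run _.
have C_epi : setprod_rv (epi q) D (row_mx (row_mx xs (fine (q xs))%:M) ss).
  split; rewrite ?row_mxKl ?row_mxKr//.
  by rewrite /epi/= row_mxKl row_mxKr mxE/= mulr1n fineK.
have C_prod : setprod_rv setT D (row_mx xs ss).
  by split; rewrite ?row_mxKr.
rewrite /M_stationary gradient_epi_violation// gradient_violation//.
rewrite !row_mxKl !row_mxKr; set r := c xs - ss.
(* When the residuals vanish along the iterates, r = 0 and both gradients are 0,
   which is a normal at every point of a set. *)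
have [mu_cvg|res_cvg] := alm_dichotomy run mu0_gt0 theta_itv kappa_itv; last first.
  have r_cvg : c (x (K j)) - s (K j) @[j --> \oo] --> r.
    by apply: cvgB s_cvg; apply: (cvg_comp _ _ x_cvg); exact: c_cont.
  have r_cvg0 : c (x (K j)) - s (K j) @[j --> \oo] --> (0 : 'rV[R]_m).
    apply/norm_cvg0P; apply: (@squeeze_cvgr _ _ _ _ (fun=> 0)
      (fun j => enorm (c (x (K j)) - s (K j)))).
    - by apply: nearW => j; rewrite normr_ge0 norm_le_enorm.
    - exact: cvg_cst.
    - exact: cvg_comp K_cvg res_cvg.
  have -> : r = 0 by exact: (cvg_unique _ r_cvg r_cvg0).
  rewrite !(mul0mx, oppr0, row_mx0).
  by split; [|move=> _]; split=> //; exact: limiting_normal0.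
(* The subgradients in the stationarity condition are only limiting ones: pass
   to regular subgradients at points zv.1 near the iterates.  The bound B + 1 is
   B for the stationarity tolerance plus 1 for the approximation. *)
have zvP j : exists zv : 'rV[R]_(n + m) * 'rV[R]_(n + m),
    [/\ regular_subdiff (aug_lagrangian q c D (mu (K j)) (yhat (K j))) zv.1 zv.2,
      `|zv.1 - row_mx (x (K j)) (s (K j))| < j.+1%:R^-1,
      `|fine (q (lsubmx zv.1)) - fine (q (x (K j)))| < j.+1%:R^-1 &
      `|zv.2| <= B + 1].
  have [eta eta_sub eta_eps] := alm_stationary run (K j).
  have j0 : 0 < j.+1%:R^-1 :> R by rewrite invr_gt0.
  have [z [v [zv_sub z_close q_close v_close]]] :=
    limiting_subdiff_aug_lagrangian q_gtNy c_diff j0 eta_sub.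
  exists (z, v); split=> //; first by move: q_close; rewrite row_mxKl.
  rewrite /= -[v](subrK eta) addrC; apply: le_trans (ler_normD _ _) _.
  rewrite lerD ?(ltW v_close)//; apply: le_trans (norm_le_enorm _) _.
  exact: le_trans eta_eps (eps_B _).
have [zv {}zvP] := choice zvP.
pose zs j := (zv j).1.
have zs_cvg : zs j @[j --> \oo] --> row_mx xs ss.
  apply: (cvg_of_close (b := fun j => row_mx (x (K j)) (s (K j)))).
    exact: (@cvg_row_mx _ _ \oo).
  by move=> j; case: (zvP j).
have fine_q_cvg : fine (q (lsubmx (zs j))) @[j --> \oo] --> fine (q xs).
  apply: (cvg_of_close (V := R) (b := fun j => fine (q (x (K j))))).
    by apply: fine_cvg; rewrite fineK.
  by move=> j; case: (zvP j).
pose mus j := mu (K j).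
have mus_gt0 j : 0 < mus j by exact: (alm_mu_gt0 run).
have mus_cvg : mus j @[j --> \oo] --> 0 by exact: cvg_comp K_cvg mu_cvg.
have ws_sub j := regular_subdiff_aug_lagrangian q_gtNy c_diff
  (let: And4 h _ _ _ := zvP j in h).
have ws_cvg : _ := cvg_penalized_subgradient (ys := yhat \o K)
  (vs := fun j => (zv j).2) c_cont c_C1 zs_cvg mus_gt0 mus_cvg
  (fun j => let: And4 _ _ _ h := zvP j in h)
  (fun j => Y_B _ (alm_yhat run (K j))).
split.
  split=> //.
  have := limiting_normal_epi zs_cvg fine_q_cvg mus_gt0 mus_cvg ws_sub
    ws_cvg D_closed (closed_epi q_lsc) q_fin.
  by rewrite !opp_row_mx oppr0 opprK.
move=> q_lip; split=> //.
have [gx0] := limiting_normal_prodT zs_cvg mus_gt0 mus_cvg ws_sub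
  ws_cvg D_closed q_lip.
by rewrite opp_row_mx opprK gx0.
Qed.
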